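(* Let $A\in\mathbb{H}^{m\times n}$, let $I\subset\{1,\dots,m\}$ and $J\subset\{1,\dots,n\}$ be index sets of cardinality $k$, let $C=A[:,J]\in\mathbb{H}^{m\times k}$, and let $B=A[I,J]\in\mathbb{H}^{k\times k}$ be nonsingular. Let $S_I\in\mathbb{R}^{k\times m}$ be the row-selection matrix with $S_IA=A[I,:]$. Define $$P=CB^{-1}S_I,\qquad A_{\rm CUR}=CB^{-1}A[I,:]=PA.$$ Then $$\|A-A_{\rm CUR}\|_F\le(1+\|P\|_2)\min_{X\in\mathbb{H}^{k\times n}}\|A-CX\|_F.$$
   Context: $\mathbb{H}$ is the skew field of real quaternions with modulus $|\cdot|$. $A[I,J]$, $A[:,J]$, $A[I,:]$ denote submatrices of $A$ with the indicated rows and columns. Nonsingular means having a two-sided inverse over $\mathbb{H}$. The row-selection matrix $S_I$ is the 0-1 matrix whose $l$th row is the standard basis row vector with a 1 in the position of the $l$th element of $I$. $\|M\|_F=(\sum_{i,j}|M_{ij}|^2)^{1/2}$ is the Frobenius norm and $\|M\|_2$ is the spectral norm (largest quaternion singular value, equivalently the operator norm of $x\mapsto Mx$ with respect to the Euclidean norms). *)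

(* Defs.v *)
From HB Require Import structures.
From mathcomp Require Import all_boot all_order all_algebra.
From mathcomp Require Import ring.
From mathcomp Require Import boolp classical_sets reals.

Set Implicit Arguments.
Unset Strict Implicit.
Unset Printing Implicit Defensive.

Import Order.TTheory GRing.Theory Num.Theory.
Local Open Scope ring_scope.

(* Quat a b c d stands for a + b i + c j + d k. *)
Record quaternion (R : Type) :=
  Quat { q_re : R; q_i : R; q_j : R; q_k : R }.

Section QuaternionChoice.
Variable R : Type.

Definition tuple_of_quat (x : quaternion R) : R * R * R * R :=
  (q_re x, q_i x, q_j x, q_k x).

Definition quat_of_tuple (t : R * R * R * R) : quaternion R :=
  let: (a, b, c, d) := t in Quat a b c d.

Lemma tuple_of_quatK : cancel tuple_of_quat quat_of_tuple.
Proof. by case. Qed.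

End QuaternionChoice.

HB.instance Definition _ (R : eqType) :=
  Equality.copy (quaternion R) (can_type (@tuple_of_quatK R)).
HB.instance Definition _ (R : choiceType) :=
  Choice.copy (quaternion R) (can_type (@tuple_of_quatK R)).

Section QuaternionRing.
Variable R : comNzRingType.
Implicit Types x y z : quaternion R.

Definition addq x y := Quat (q_re x + q_re y) (q_i x + q_i y)
                            (q_j x + q_j y) (q_k x + q_k y).

Definition oppq x := Quat (- q_re x) (- q_i x) (- q_j x) (- q_k x).

Definition mulq x y :=
  let: Quat a1 b1 c1 d1 := x in
  let: Quat a2 b2 c2 d2 := y in
  Quat (a1 * a2 - b1 * b2 - c1 * c2 - d1 * d2)
       (a1 * b2 + b1 * a2 + c1 * d2 - d1 * c2)
       (a1 * c2 - b1 * d2 + c1 * a2 + d1 * b2)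
       (a1 * d2 + b1 * c2 - c1 * b2 + d1 * a2).

Definition zeroq : quaternion R := Quat 0 0 0 0.
Definition oneq : quaternion R := Quat 1 0 0 0.

Lemma addqA : associative addq.
Proof. by move=> x y z; rewrite /addq /= !addrA. Qed.

Lemma addqC : commutative addq.
Proof.
move=> x y.
by rewrite /addq (addrC (q_re x)) (addrC (q_i x)) (addrC (q_j x))
           (addrC (q_k x)).
Qed.

Lemma add0q : left_id zeroq addq.
Proof. by case=> a b c d; rewrite /addq /= !add0r. Qed.

Lemma addNq : left_inverse zeroq oppq addq.
Proof. by case=> a b c d; rewrite /addq /= !addNr. Qed.

Lemma mulqA : associative mulq.
Proof.
by case=> ? ? ? ? [? ? ? ?] [? ? ? ?]; rewrite /mulq /=; congr Quat; ring.
Qed.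

Lemma mul1q : left_id oneq mulq.
Proof. by case=> ? ? ? ?; rewrite /mulq /=; congr Quat; ring. Qed.

Lemma mulq1 : right_id oneq mulq.
Proof. by case=> ? ? ? ?; rewrite /mulq /=; congr Quat; ring. Qed.

Lemma mulqDl : left_distributive mulq addq.
Proof.
by case=> ? ? ? ? [? ? ? ?] [? ? ? ?]; rewrite /mulq /addq /=; congr Quat; ring.
Qed.

Lemma mulqDr : right_distributive mulq addq.
Proof.
by case=> ? ? ? ? [? ? ? ?] [? ? ? ?]; rewrite /mulq /addq /=; congr Quat; ring.
Qed.

Lemma oneq_neq0 : oneq != zeroq.
Proof. by apply/eqP => -[/eqP]; rewrite oner_eq0. Qed.

HB.instance Definition _ :=
  GRing.isZmodule.Build (quaternion R) addqA addqC add0q addNq.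
HB.instance Definition _ :=
  GRing.Zmodule_isNzRing.Build (quaternion R)
    mulqA mul1q mulq1 mulqDl mulqDr oneq_neq0.

End QuaternionRing.

(* unitmx and invmx require a commutative coefficient ring, hence the
   following versions; inv_ncmx B is a two-sided inverse of B if there is one,
   and 0 otherwise. *)
Definition ncmx_inverse (T : nzRingType) (k : nat) (B B' : 'M[T]_k) : Prop :=
  B *m B' = 1%:M /\ B' *m B = 1%:M.

Definition nonsingular (T : nzRingType) (k : nat) (B : 'M[T]_k) : Prop :=
  exists B' : 'M[T]_k, ncmx_inverse B B'.

Definition inv_ncmx (T : nzRingType) (k : nat) (B : 'M[T]_k) : 'M[T]_k :=
  xget 0 [set B' | ncmx_inverse B B'].

(* nth_elt cI l is the l-th element of I in increasing order: enum lists the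
   elements of a set of ordinals increasingly. *)
Definition nth_elt (m k : nat) (I : {set 'I_m}) (cI : #|I| = k) (l : 'I_k) :
    'I_m :=
  enum_val (cast_ord (esym cI) l).

Definition row_selection (T : nzRingType) (m k : nat) (I : {set 'I_m})
    (cI : #|I| = k) : 'M[T]_(k, m) :=
  \matrix_(l < k, i < m) (i == nth_elt cI l)%:R.

Lemma row_selection_mul (T : nzRingType) (m n k : nat) (A : 'M[T]_(m, n))
    (I : {set 'I_m}) (cI : #|I| = k) :
  row_selection T cI *m A = rowsub (nth_elt cI) A.
Proof.
apply/matrixP => l j; rewrite !mxE (bigD1 (nth_elt cI l)) //= !mxE eqxx mul1r.
by rewrite big1 ?addr0 // => i /negbTE ni; rewrite mxE ni mul0r.
Qed.

Section Norms.
Variable R : realType.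

Definition qmod (x : quaternion R) : R :=
  Num.sqrt (q_re x ^+ 2 + q_i x ^+ 2 + q_j x ^+ 2 + q_k x ^+ 2).

Definition frobenius (m n : nat) (M : 'M[quaternion R]_(m, n)) : R :=
  Num.sqrt (\sum_(i < m) \sum_(j < n) qmod (M i j) ^+ 2).

(* The operator norm of x |-> M x; on column vectors, frobenius is the
   Euclidean norm. *)
Definition spectral_norm (m n : nat) (M : 'M[quaternion R]_(m, n)) : R :=
  sup [set frobenius (M *m x) | x in
        [set x : 'cV[quaternion R]_n | frobenius x <= 1]]%classic.

End Norms.

(* Main.v *)
(** Since B is nonsingular, P C = C, so A - P A = (1 - P)(A - C X) for every X,
    and the triangle inequality together with |P E|_F <= |P|_2 |E|_F gives the
    bound.  A minimizer X exists because the columns of A can be projected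
    orthogonally onto the right span of the columns of C, by Gram-Schmidt
    elimination of one column of C at a time. *)
Require Import Defs.
From mathcomp Require Import all_boot all_order all_algebra.
From mathcomp Require Import ring.
From mathcomp Require Import boolp classical_sets reals.

Set Implicit Arguments.
Unset Strict Implicit.

Import Order.TTheory GRing.Theory Num.Theory.
Local Open Scope ring_scope.

(** * Cauchy-Schwarz and Minkowski for finite real sums *)

Section EuclideanSums.
Variables (R : rcfType) (T : finType).
Implicit Types f g : T -> R.

Lemma sum_cauchy_schwarz f g :
  (\sum_i f i * g i) ^+ 2 <= (\sum_i f i ^+ 2) * (\sum_i g i ^+ 2).
Proof.
set D := \sum_i f i * g i; set F := \sum_i f i ^+ 2; set G := \sum_i g i ^+ 2.
have expand (s t : R) :
    \sum_i (s * f i - t * g i) ^+ 2 = s ^+ 2 * F - 2 * s * t * D + t ^+ 2 * G.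
  rewrite !mulr_sumr -sumrB -big_split /=.
  by apply: eq_bigr => i _; ring.
have F0 : 0 <= F by apply: sumr_ge0 => i _; exact: sqr_ge0.
have G0 : 0 <= G by apply: sumr_ge0 => i _; exact: sqr_ge0.
have [Gz|Gnz] := eqVneq G 0.
  have gz i : g i = 0.
    apply/eqP; rewrite -sqrf_eq0.
    have /allP/(_ i (mem_index_enum i)) :=
      etrans (esym (psumr_eq0 _ (fun i _ => sqr_ge0 (g i)))) (introT eqP Gz).
    by [].
  by rewrite /D big1 ?expr0n ?mulr_ge0 // => i _; rewrite gz mulr0.
have Gp : 0 < G by rewrite lt_def Gnz.
(* Multiplying by [G] keeps the sign because [G] is positive here. The choice [s = G], [t = D] in
   [expand] then turns the difference into a sum of squares. *)
rewrite -subr_ge0 -(pmulr_rge0 _ Gp).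
suff -> : G * (F * G - D ^+ 2) = \sum_i (G * f i - D * g i) ^+ 2.
  by apply: sumr_ge0 => i _; exact: sqr_ge0.
by rewrite expand; ring.
Qed.

(** After squaring, the two sides differ only in their cross terms, which Cauchy-Schwarz
    compares. *)
Lemma sum_minkowski f g :
  Num.sqrt (\sum_i (f i + g i) ^+ 2) <=
  Num.sqrt (\sum_i f i ^+ 2) + Num.sqrt (\sum_i g i ^+ 2).
Proof.
have ge0 h : 0 <= \sum_(i : T) h i ^+ 2 :> R.
  by apply: sumr_ge0 => i _; exact: sqr_ge0.
rewrite -[leRHS]ger0_norm ?addr_ge0 ?sqrtr_ge0 // -sqrtr_sqr.
rewrite ler_sqrt ?sqr_ge0 // sqrrD !sqr_sqrtr //.
have -> : \sum_i (f i + g i) ^+ 2 = \sum_i f i ^+ 2 + (\sum_i f i * g i) *+ 2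
    + \sum_i g i ^+ 2.
  rewrite -mulr_natl mulr_sumr -!big_split /=.
  by apply: eq_bigr => i _; ring.
rewrite lerD2r lerD2l ler_pMn2r // -sqrtrM //.
apply: le_trans (ler_norm _) _.
by rewrite -sqrtr_sqr ler_wsqrtr // sum_cauchy_schwarz.
Qed.

End EuclideanSums.

(** * Modulus and conjugation of quaternions *)

Section QuaternionMatrices.
Variable R : realType.
Local Notation H := (quaternion R).
Implicit Types x y : H.

Lemma qmod_sqr x :
  qmod x ^+ 2 = q_re x ^+ 2 + q_i x ^+ 2 + q_j x ^+ 2 + q_k x ^+ 2.
Proof. by rewrite sqr_sqrtr // !addr_ge0 ?sqr_ge0. Qed.

Lemma qmod_ge0 x : 0 <= qmod x.
Proof. exact: sqrtr_ge0. Qed.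

(** Under the square root this is Euler's four-square identity. *)
Lemma qmodM x y : qmod (x * y) = qmod x * qmod y.
Proof.
rewrite /qmod -sqrtrM ?addr_ge0 ?sqr_ge0 //.
by case: x y => ? ? ? ? [? ? ? ?] /=; congr Num.sqrt; ring.
Qed.

Lemma qmod_triangle x y : qmod (x + y) <= qmod x + qmod y.
Proof.
(* A quaternion viewed as a vector of four real coordinates, so that Minkowski applies. *)
pose co (z : H) (l : 'I_4) := [:: q_re z; q_i z; q_j z; q_k z]`_l.
have qmodE z : qmod z = Num.sqrt (\sum_l co z l ^+ 2).
  by rewrite /qmod !big_ord_recl big_ord0 addr0 !addrA.
rewrite !qmodE; apply: le_trans _ (sum_minkowski (co x) (co y)).
by rewrite !big_ord_recl !big_ord0.
Qed.

Definition qreal (a : R) : H := Quat a 0 0 0.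

Lemma qrealM (a b : R) : qreal (a * b) = qreal a * qreal b.
Proof. by congr Quat; ring. Qed.

Lemma qmod_qreal (a : R) : 0 <= a -> qmod (qreal a) = a.
Proof. by move=> a0; rewrite /qmod /= !expr0n !addr0 sqrtr_sqr ger0_norm. Qed.

Definition conjq x : H := Quat (q_re x) (- q_i x) (- q_j x) (- q_k x).

Lemma conjqK : involutive conjq.
Proof. by case=> a b c d; rewrite /conjq /= !opprK. Qed.

Lemma conjqM x y : conjq (x * y) = conjq y * conjq x.
Proof. by case: x y => ? ? ? ? [? ? ? ?]; congr Quat => /=; ring. Qed.

Lemma conjqB x y : conjq (x - y) = conjq x - conjq y.
Proof. by case: x y => ? ? ? ? [? ? ? ?]; congr Quat => /=; ring. Qed.

Lemma conjq0 : conjq 0 = 0.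
Proof. by congr Quat; rewrite /= oppr0. Qed.

Lemma conjqD x y : conjq (x + y) = conjq x + conjq y.
Proof. by case: x y => ? ? ? ? [? ? ? ?]; congr Quat => /=; ring. Qed.

Lemma conjq_mul x : conjq x * x = qreal (qmod x ^+ 2).
Proof. by rewrite qmod_sqr; case: x => ? ? ? ?; congr Quat => /=; ring. Qed.

Lemma qmodD_sqr x y :
  qmod (x + y) ^+ 2 = qmod x ^+ 2 + qmod y ^+ 2 + q_re (conjq x * y) *+ 2.
Proof. by rewrite !qmod_sqr; case: x y => ? ? ? ? [? ? ? ?] /=; ring. Qed.

Lemma q_re_sum (T : finType) (f : T -> H) :
  q_re (\sum_i f i) = \sum_i q_re (f i).
Proof. by apply: (big_morph (@q_re R)). Qed.

Lemma qreal_sum (T : finType) (f : T -> R) :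
  \sum_i qreal (f i) = qreal (\sum_i f i).
Proof.
apply/esym/(big_morph qreal) => // a b.
by congr Quat => /=; rewrite addr0.
Qed.

(** * Conjugate transpose *)

Definition adj {m n} (M : 'M[H]_(m, n)) : 'M[H]_(n, m) := map_mx conjq M^T.

Lemma adjK m n (M : 'M[H]_(m, n)) : adj (adj M) = M.
Proof. by apply/matrixP => i j; rewrite !mxE conjqK. Qed.

Lemma adj0 m n : adj (0 : 'M[H]_(m, n)) = 0.
Proof. by apply/matrixP => i j; rewrite !mxE conjq0. Qed.

Lemma adjB m n (M N : 'M[H]_(m, n)) : adj (M - N) = adj M - adj N.
Proof. by apply/matrixP => i j; rewrite !mxE conjqB. Qed.

(** Transposition alone does not reverse products over a noncommutative ring; conjugation swaps the
    factors of each entry and repairs this. *)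
Lemma adjM m n p (M : 'M[H]_(m, n)) (N : 'M[H]_(n, p)) :
  adj (M *m N) = adj N *m adj M.
Proof.
apply/matrixP => i j; rewrite !mxE (big_morph _ conjqD conjq0).
by apply: eq_bigr => l _; rewrite !mxE conjqM.
Qed.

(** Symmetry of orthogonality between the columns of two matrices. *)
Lemma adj_mul_eq0 m n p (M : 'M[H]_(m, n)) (N : 'M[H]_(m, p)) :
  adj M *m N = 0 -> adj N *m M = 0.
Proof. by move=> MN; rewrite -[M]adjK -adjM MN adj0. Qed.

(** * The Frobenius norm *)

Lemma frobenius_ge0 m n (M : 'M[H]_(m, n)) : 0 <= frobenius M.
Proof. exact: sqrtr_ge0. Qed.

Lemma frobenius_sqr m n (M : 'M[H]_(m, n)) :
  frobenius M ^+ 2 = \sum_i \sum_j qmod (M i j) ^+ 2.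
Proof.
rewrite sqr_sqrtr //; apply: sumr_ge0 => i _; apply: sumr_ge0 => j _.
exact: sqr_ge0.
Qed.

Lemma frobenius_sqr_col m n (M : 'M[H]_(m, n)) :
  frobenius M ^+ 2 = \sum_j frobenius (col j M) ^+ 2.
Proof.
rewrite frobenius_sqr exchange_big /=; apply: eq_bigr => j _.
by rewrite frobenius_sqr; apply: eq_bigr => i _; rewrite big_ord1 mxE.
Qed.

Lemma frobenius_eq0 m n (M : 'M[H]_(m, n)) : frobenius M = 0 -> M = 0.
Proof.
move=> M0.
have := frobenius_sqr M; rewrite M0 expr0n /= => /esym.
have ge0 i j : 0 <= qmod (M i j) ^+ 2 by exact: sqr_ge0.
move=> /psumr_eq0P rows; apply/matrixP => i j; rewrite mxE.
have /psumr_eq0P cols := rows (fun i _ => sumr_ge0 _ (fun j _ => ge0 i j)) i isT.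
have := cols (fun j _ => ge0 i j) j isT; rewrite qmod_sqr.
case: (M i j) => a b c d /= /eqP.
by rewrite !paddr_eq0 ?addr_ge0 ?sqr_ge0 // !sqrf_eq0 =>
  /andP[/andP[/andP[/eqP-> /eqP->] /eqP->] /eqP->].
Qed.

Lemma frobenius0 m n : frobenius (0 : 'M[H]_(m, n)) = 0.
Proof.
rewrite /frobenius big1 ?sqrtr0 // => i _; rewrite big1 // => j _.
by rewrite mxE qmod_sqr /= !expr0n !addr0.
Qed.

Lemma frobeniusN m n (M : 'M[H]_(m, n)) : frobenius (- M) = frobenius M.
Proof.
congr Num.sqrt; apply: eq_bigr => i _; apply: eq_bigr => j _.
by rewrite !mxE !qmod_sqr /= !sqrrN.
Qed.

Lemma frobenius_triangle m n (M N : 'M[H]_(m, n)) :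
  frobenius (M + N) <= frobenius M + frobenius N.
Proof.
rewrite /frobenius !pair_bigA /=.
apply: le_trans _ (sum_minkowski _ _).
apply: ler_wsqrtr; apply: ler_sum => -[i j] _ /=.
by rewrite mxE ler_pXn2r ?nnegrE ?addr_ge0 ?qmod_ge0 ?qmod_triangle.
Qed.

Lemma frobenius_sum m n (T : finType) (F : T -> 'M[H]_(m, n)) :
  frobenius (\sum_i F i) <= \sum_i frobenius (F i).
Proof.
elim/big_ind2: _ => [|M a N b Ma Nb|//]; first by rewrite frobenius0.
exact: le_trans (frobenius_triangle _ _) (lerD Ma Nb).
Qed.

(** Scalars act on the right, as 1 by 1 matrices, so that associativity of [*m] lets left
    multiplication by a matrix commute with scaling. *)
Lemma frobenius_mul_scalar m (u : 'cV[H]_m) (q : H) :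
  frobenius (u *m q%:M) = frobenius u * qmod q.
Proof.
rewrite -[RHS]ger0_norm ?mulr_ge0 ?frobenius_ge0 ?qmod_ge0 // -sqrtr_sqr.
rewrite exprMn frobenius_sqr mulr_suml; congr Num.sqrt.
apply: eq_bigr => i _.
by rewrite !big_ord1 !mxE big_ord1 !mxE eqxx mulr1n qmodM exprMn.
Qed.

(** * Orthogonality and least squares *)

Lemma adj_mul_self m (u : 'cV[H]_m) :
  adj u *m u = (qreal (frobenius u ^+ 2))%:M.
Proof.
rewrite frobenius_sqr -qreal_sum [LHS]mx11_scalar mxE; congr _%:M.
by apply: eq_bigr => i _; rewrite !mxE big_ord1 conjq_mul.
Qed.

(** Expanding entrywise leaves twice [cross], the real part of the trace of [adj M *m N]. *)
Lemma frobenius_pythagoras m n (M N : 'M[H]_(m, n)) :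
  adj M *m N = 0 ->
  frobenius (M + N) ^+ 2 = frobenius M ^+ 2 + frobenius N ^+ 2.
Proof.
move=> MN; rewrite !frobenius_sqr.
set cross := \sum_i \sum_j q_re (conjq (M i j) * N i j).
have cross0 : cross = 0.
  rewrite /cross exchange_big big1 //= => j _.
  have /matrixP/(_ j j)/(congr1 (@q_re R)) := MN.
  rewrite !mxE q_re_sum; apply: etrans.
  by apply: eq_bigr => i _; rewrite !mxE.
suff -> : \sum_i \sum_j qmod ((M + N) i j) ^+ 2 =
    \sum_i \sum_j qmod (M i j) ^+ 2 + \sum_i \sum_j qmod (N i j) ^+ 2 +
    cross *+ 2 by rewrite cross0 mul0rn addr0.
rewrite /cross -sumrMnl -!big_split /=.
apply: eq_bigr => i _; rewrite -sumrMnl -!big_split /=.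
by apply: eq_bigr => j _; rewrite mxE qmodD_sqr.
Qed.

(** Induction on the number of columns of [C]. The induction hypothesis is general in [V], since it
    is applied both to the first column [c] and to [V]: the residuals [r] and [F] are orthogonal to
    the remaining columns [C'], and it remains to remove from [F] its component along [r]. *)
Lemma orthogonal_projection m n k (C : 'M[H]_(m, k)) (V : 'M[H]_(m, n)) :
  exists X, adj (V - C *m X) *m C = 0.
Proof.
elim: k n C V => [|k IHk] n C V.
  by exists 0; apply/matrixP => i [].
rewrite -[k.+1]/(1 + k)%N in C *; rewrite -(hsubmxK C).
set c := lsubmx _; set C' := rsubmx _.
have [y ry] := IHk _ C' c; have [X FX] := IHk _ C' V.
set r := c - C' *m y in ry; set F := V - C' *m X in FX.
have cE : c = r + C' *m y by rewrite subrK.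
(* Coefficients of the projection of [F] onto the right span of [r]. No independence of the columns
   is assumed: if [r] is zero, orthogonality to it is trivial. *)
pose T := (qreal (frobenius r ^+ 2)^-1)%:M *m (adj r *m F).
have wr : adj (F - r *m T) *m r = 0.
  apply: adj_mul_eq0; have [r0|rn0] := eqVneq (frobenius r) 0.
    by rewrite (frobenius_eq0 r0) adj0 mul0mx.
  rewrite mulmxBr mulmxA adj_mul_self /T (mulmxA _%:M _%:M) -scalar_mxM -qrealM.
  by rewrite divff ?expf_neq0 // mul1mx subrr.
move: T wr => T wr.
have wC : adj (F - r *m T) *m C' = 0.
  by rewrite adjB mulmxBl FX adjM -mulmxA ry mulmx0 subr0.
(* Substituting [r = c - C' *m y] in [C' *m X + r *m T] gives coefficient [T] on [c] and
   [X - y *m T] on [C']. *)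
exists (col_mx T (X - y *m T)).
have -> : V - row_mx c C' *m col_mx T (X - y *m T) = F - r *m T.
  rewrite mul_row_col cE mulmxDl mulmxBr (mulmxA C') -addrA.
  by rewrite [X in _ *m T + X]addrC subrK opprD addrA addrAC.
by rewrite mul_mx_row cE mulmxDr wr mulmxA wC mul0mx addr0 row_mx0.
Qed.

(** The residual of the projection is orthogonal to [C *m (X0 - X)], so by Pythagoras any other [X]
    adds a nonnegative term to the squared norm. *)
Lemma least_squares_minimizer m n k (C : 'M[H]_(m, k)) (V : 'M[H]_(m, n)) :
  exists X0, forall X, frobenius (V - C *m X0) <= frobenius (V - C *m X).
Proof.
have [X0 orth] := orthogonal_projection C V; exists X0 => X.
rewrite -(@ler_pXn2r _ 2) ?nnegrE ?frobenius_ge0 //.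
have -> : V - C *m X = V - C *m X0 + C *m (X0 - X).
  by rewrite mulmxBr addrA subrK.
rewrite [leRHS]frobenius_pythagoras ?lerDl ?sqr_ge0 //.
by rewrite mulmxA orth mul0mx.
Qed.

(** * The spectral norm as an operator bound *)

Lemma frobenius_mulmx_le_sum m n (M : 'M[H]_(m, n)) (x : 'cV[H]_n) :
  frobenius x <= 1 -> frobenius (M *m x) <= \sum_j frobenius (col j M).
Proof.
move=> x1.
(* A right combination of the columns of [M], whose coefficients have modulus at most [frobenius x],
   hence at most 1. *)
have -> : M *m x = \sum_j col j M *m (x j 0)%:M.
  apply/matrixP => i j; rewrite !mxE summxE; apply: eq_bigr => l _.
  by rewrite ord1 !mxE big_ord1 !mxE mulr1n.
apply: le_trans (frobenius_sum _) _; apply: ler_sum => j _.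
rewrite frobenius_mul_scalar ler_piMr ?frobenius_ge0 //.
apply: le_trans x1; rewrite -(@ler_pXn2r _ 2) ?nnegrE ?frobenius_ge0 ?qmod_ge0 //.
rewrite frobenius_sqr (bigD1 j) //= big_ord1 lerDl.
by apply: sumr_ge0 => l _; rewrite big_ord1 sqr_ge0.
Qed.

Lemma spectral_norm_ub m n (M : 'M[H]_(m, n)) (x : 'cV[H]_n) :
  frobenius x <= 1 -> frobenius (M *m x) <= spectral_norm M.
Proof.
move=> x1; apply: ub_le_sup; last by exists x.
(* The set under [sup] must be shown bounded before its supremum is known to dominate its
   elements. *)
by exists (\sum_j frobenius (col j M)) => _ [y y1 <-]; exact: frobenius_mulmx_le_sum.
Qed.

Lemma spectral_norm_ge0 m n (M : 'M[H]_(m, n)) : 0 <= spectral_norm M.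
Proof.
apply: le_trans (@spectral_norm_ub _ _ M 0 _); first exact: frobenius_ge0.
by rewrite frobenius0.
Qed.

(** A nonzero [x] is normalized by the real quaternion [qreal (frobenius x)^-1] acting on the right,
    which passes through [M]. *)
Lemma frobenius_mul_col m n (M : 'M[H]_(m, n)) (x : 'cV[H]_n) :
  frobenius (M *m x) <= spectral_norm M * frobenius x.
Proof.
have [x0|xn0] := eqVneq (frobenius x) 0.
  by rewrite (frobenius_eq0 x0) mulmx0 !frobenius0 mulr0.
have xp : 0 < frobenius x by rewrite lt_def xn0 frobenius_ge0.
have qE : qmod (qreal (frobenius x)^-1) = (frobenius x)^-1.
  by rewrite qmod_qreal // invr_ge0 ltW.
rewrite -ler_pdivrMr // -qE -frobenius_mul_scalar -mulmxA.
by apply: spectral_norm_ub; rewrite frobenius_mul_scalar qE divff.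
Qed.

(** Squared Frobenius norms add up over columns, so the bound for single columns suffices. *)
Lemma frobenius_mul m n p (M : 'M[H]_(m, n)) (N : 'M[H]_(n, p)) :
  frobenius (M *m N) <= spectral_norm M * frobenius N.
Proof.
rewrite -(@ler_pXn2r _ 2) ?nnegrE ?mulr_ge0 ?frobenius_ge0 ?spectral_norm_ge0 //.
rewrite exprMn !frobenius_sqr_col mulr_sumr; apply: ler_sum => j _.
rewrite -exprMn ler_pXn2r ?nnegrE ?mulr_ge0 ?frobenius_ge0 ?spectral_norm_ge0 //.
by rewrite colE -mulmxA -colE frobenius_mul_col.
Qed.

End QuaternionMatrices.

(** * The CUR error bound *)

Lemma inv_ncmxP (T : nzRingType) (k : nat) (B : 'M[T]_k) :
  nonsingular B -> ncmx_inverse B (inv_ncmx B).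
Proof. by case=> B' BB'; exact: (@xgetPex _ 0 _ (ex_intro _ B' BB')). Qed.

Unset Implicit Arguments.
Set Strict Implicit.

Theorem proposition3 (R : realType) (m n k : nat)
    (A : 'M[quaternion R]_(m, n)) (I : {set 'I_m}) (J : {set 'I_n})
    (cI : #|I| = k) (cJ : #|J| = k) :
  let C : 'M[quaternion R]_(m, k) := colsub (nth_elt cJ) A in
  let B : 'M[quaternion R]_k := mxsub (nth_elt cI) (nth_elt cJ) A in
  let S : 'M[quaternion R]_(k, m) := row_selection (quaternion R) cI in
  let P : 'M[quaternion R]_m := C *m inv_ncmx B *m S in
  let Acur : 'M[quaternion R]_(m, n) :=
    C *m inv_ncmx B *m rowsub (nth_elt cI) A in
  nonsingular B ->
  Acur = P *m A /\
  exists X0 : 'M[quaternion R]_(k, n),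
    (forall X : 'M[quaternion R]_(k, n),
       frobenius (A - C *m X0) <= frobenius (A - C *m X)) /\
    frobenius (A - Acur) <= (1 + spectral_norm P) * frobenius (A - C *m X0).
Proof.
move=> C B S P Acur nsB.
have AcurE : Acur = P *m A by rewrite /Acur /P -(row_selection_mul A cI) mulmxA.
split=> //.
have SC : S *m C = B.
  by rewrite /S row_selection_mul; apply/matrixP => i j; rewrite !mxE.
(* By [SC], the product is [C *m inv_ncmx B *m B]. *)
have PC : P *m C = C.
  by rewrite /P -!mulmxA SC; have [_ ->] := inv_ncmxP nsB; rewrite mulmx1.
have [X0 minX0] := least_squares_minimizer C A; exists X0; split=> //.
set E := A - C *m X0.
(* The two [C *m X0] terms of the right-hand side cancel because [P] fixes [C]. *)
have -> : A - Acur = E - P *m E.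
  by rewrite AcurE mulmxBr (mulmxA P) PC opprB addrA subrK.
rewrite mulrDl mul1r; apply: le_trans (frobenius_triangle _ _) _.
by rewrite frobeniusN lerD2l frobenius_mul.
Qed.
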